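(* Let $\mathbb{F}=\mathbb{F}_2$ and let $D$ be the free $\mathbb{F}[U,V]$-module on the $21$ generators $x,\ x',\ x_0,x_1,x_2,x_3,x_4,\ y_1,y_2,y_3,y_4,\ p_1,p_2,p_3,p_4,\ q_1,q_2,q_3,q_4,\ h,\ k$ with differential $$\partial x=\partial x'=\partial x_1=\partial y_1=0,$$ $$\partial p_1=V^4x,\quad \partial x_4=UV^3x,\quad \partial x_3=V^2x_4+UVp_1,\quad \partial p_2=U^2p_1+UVx_4,\quad \partial p_3=V^2p_2+UVx_3,$$ $$\partial x_2=V^3x_1+U^2x_3+UVp_2,\quad \partial p_4=U^5x+UVy_1+U^2V^3x',\quad \partial h=U^4p_3+V^5p_4+U^3Vx_2+UV^4x_0,$$ $$\partial x_0=U^2x_1+V^2y_1+U^4Vx+UV^4x',$$ $$\partial q_1=U^4x',\quad \partial y_4=U^3Vx',\quad \partial y_3=U^2y_4+UVq_1,\quad \partial q_2=V^2q_1+UVy_4,\quad \partial q_3=U^2q_2+UVy_3,$$ $$\partial y_2=U^3y_1+V^2y_3+UVq_2,\quad \partial q_4=V^5x'+UVx_1+U^3V^2x,\quad \partial k=V^4q_3+U^5q_4+UV^3y_2+U^4Vx_0,$$ with the $\mathbb{Z}\oplus\mathbb{Z}$ grading determined by $\mathrm{gr}(x_4)=(10,0)$. The knot Floer-like complex $D$ has the following property: it is not chain homotopy equivalent to any knot Floer-like complex of the form $C\otimes_{\mathbb{F}}\mathbb{F}[U,V]$ where $C$ is finitely generated as an $\mathbb{F}$-module.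
   Context: $\mathbb{F}[U,V]$ is $\mathbb{Z}\oplus\mathbb{Z}$ graded by $\mathrm{gr}=(\mathrm{gr}_U,\mathrm{gr}_V)$ with $\mathrm{gr}(U)=(-2,0)$, $\mathrm{gr}(V)=(0,-2)$. All modules and complexes are $\mathbb{Z}\oplus\mathbb{Z}$ graded; a chain complex $(C,\partial)$ is a graded module with a module endomorphism $\partial$ of degree $(-1,-1)$, $\partial^2=0$. Bases are homogeneous, chain maps preserve the grading, chain homotopies have degree $(1,1)$, $\simeq$ is chain homotopy equivalence. $C/U$, $C/V$ denote $C$ with $U=0$, respectively $V=0$. A knot Floer-like complex is a finitely generated free chain complex $C$ over $\mathbb{F}[U,V]$ that is symmetric, i.e. $C\simeq\overline{C}$ where $\overline{C}$ is $C$ with the roles of $U$ and $V$ interchanged and $\mathrm{gr}_U,\mathrm{gr}_V$ switched, and has the homology of a knot in $S^3$: $H_*(C/U)/(V\text{-torsion})\cong\mathbb{F}[V]$ with generator in $\mathrm{gr}_U=0$, and $H_*(C/V)/(U\text{-torsion})\cong\mathbb{F}[U]$ with generator in $\mathrm{gr}_V=0$. Meaning of ''of the form $C\otimes_{\mathbb{F}}\mathbb{F}[U,V]$ with $C$ finitely generated'': the complex consists of a finite piece in the plane together with its translates, that is, it has a finite homogeneous basis $z_1,\dots,z_n$ and lattice points $(r_i,t_i)\in\mathbb{Z}^2$ such that $\partial z_i=\sum_j c_{ij}\,U^{r_i-r_j}V^{t_i-t_j}z_j$ for all $i$, with $c_{ij}\in\mathbb{F}$ and $c_{ij}=0$ unless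 $r_i\ge r_j$ and $t_i\ge t_j$. Here $C$ is the finite-dimensional $\mathbb{F}$-complex spanned by the generators $z_i$ placed at $(r_i,t_i)$ with differential matrix $(c_{ij})$. *)

(* Defs.v *)
From mathcomp Require Import all_boot all_order all_algebra.
From mathcomp Require Import ring.

Set Implicit Arguments.
Unset Strict Implicit.
Unset Printing Implicit Defensive.

Import Order.TTheory GRing.Theory Num.Theory.
Local Open Scope ring_scope.

(* F[U,V] is represented as F[V][U]: the outer variable is U, so that
   p`_a`_b is the coefficient of U^a V^b in p. *)
Notation F2UV := {poly {poly 'F_2}}.
Definition U : F2UV := 'X.
Definition V : F2UV := 'Y.

Definition bidegree : Type := (int * int)%type.

(* gr(U^a V^b) = (-2a, -2b); the zero polynomial is homogeneous of every
   degree. *)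
Definition homog (e : bidegree) (p : F2UV) : Prop :=
  forall a b : nat, p`_a`_b != 0 -> e = (- (2 * a)%:Z, - (2 * b)%:Z).

(* The row vector v stands for the element \sum_j v_j z_j of the free module
   with homogeneous basis z_j of degree gr j. *)
Definition row_homog n (gr : 'I_n -> bidegree) (v : 'rV[F2UV]_n)
    (e : bidegree) : Prop :=
  forall j, homog (e - gr j) (v 0 j).

(* A matrix stands for the module map sending the i-th basis element to the
   element given by the i-th row, hence acts on row vectors by right
   multiplication; "f, then g" is f *m g. *)
Definition mx_homog m n (e : bidegree) (gr : 'I_m -> bidegree)
    (gr' : 'I_n -> bidegree) (f : 'M[F2UV]_(m, n)) : Prop :=
  forall i, row_homog gr' (row i f) (gr i + e).

(* Finitely generated free bigraded chain complexes over F[U,V], with a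
   homogeneous basis. *)
Record complex := Complex {
  rk : nat;
  gr : 'I_rk -> bidegree;
  diff : 'M[F2UV]_rk;
  diff_homog : mx_homog (-1, -1) gr gr diff;
  diff_sq0 : diff *m diff = 0
}.

Definition chain_map (C D : complex) (f : 'M[F2UV]_(rk C, rk D)) : Prop :=
  mx_homog 0 (@gr C) (@gr D) f /\ diff C *m f = f *m diff D.

Definition chain_homotopic (C D : complex) (f g : 'M[F2UV]_(rk C, rk D)) :
    Prop :=
  exists H : 'M[F2UV]_(rk C, rk D),
    mx_homog (1, 1) (@gr C) (@gr D) H /\
    f - g = diff C *m H + H *m diff D.

Definition homotopy_equiv (C D : complex) : Prop :=
  exists (f : 'M[F2UV]_(rk C, rk D)) (g : 'M[F2UV]_(rk D, rk C)),
    [/\ chain_map f, chain_map g,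
        @chain_homotopic C C (f *m g) 1%:M
      & @chain_homotopic D D (g *m f) 1%:M].

Section Bar.
Variable C : complex.

Definition bar_gr (i : 'I_(rk C)) : bidegree := ((gr i).2, (gr i).1).
Definition bar_diff : 'M[F2UV]_(rk C) :=
  map_mx (@swapXY 'F_2) (diff C).

Lemma bar_diff_homog : mx_homog (-1, -1) bar_gr bar_gr bar_diff.
Proof.
move=> i j a b; rewrite !mxE coef_swapXY => nz.
have := @diff_homog C i j b a; rewrite mxE => /(_ nz).
by rewrite /bar_gr; case: (gr i) (gr j) => [u v] [u' v'] /= [<- <-].
Qed.

Lemma bar_diff_sq0 : bar_diff *m bar_diff = 0.
Proof. by rewrite /bar_diff -map_mxM diff_sq0 map_mx0. Qed.

Definition bar : complex := Complex bar_diff_homog bar_diff_sq0.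
End Bar.

(* Reduction of F[U,V] modulo U (with values in F[V]) and modulo V (with
   values in F[U]). *)
Definition mod_U : F2UV -> {poly 'F_2} := horner_eval 0.
Definition mod_V : F2UV -> {poly 'F_2} := map_poly (horner_eval 0).

Definition row_homog_mod_U n (gr : 'I_n -> bidegree) (v : 'rV[{poly 'F_2}]_n)
    (e : bidegree) : Prop :=
  forall j (b : nat), (v 0 j)`_b != 0 -> e - gr j = (0, - (2 * b)%:Z).

Definition row_homog_mod_V n (gr : 'I_n -> bidegree) (v : 'rV[{poly 'F_2}]_n)
    (e : bidegree) : Prop :=
  forall j (a : nat), (v 0 j)`_a != 0 -> e - gr j = (- (2 * a)%:Z, 0).

Section HomologyModTorsion.
Variables (n : nat) (d : 'M[{poly 'F_2}]_n).

Definition is_cycle (v : 'rV[{poly 'F_2}]_n) : Prop := v *m d = 0.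
Definition is_boundary (v : 'rV[{poly 'F_2}]_n) : Prop :=
  exists w, v = w *m d.

(* For a cycle v: the class of v in homology is killed by a power of the
   variable, i.e. vanishes in H_* / torsion. *)
Definition torsion_class (v : 'rV[{poly 'F_2}]_n) : Prop :=
  exists k : nat, is_boundary ('X^k *: v).

(* z is a cycle and p |-> p [z] is an isomorphism from the polynomial ring
   onto H_* / torsion (the last two clauses are surjectivity and
   injectivity). *)
Definition free_generator_mod_torsion (z : 'rV[{poly 'F_2}]_n) : Prop :=
  [/\ is_cycle z,
      (forall v, is_cycle v -> exists p : {poly 'F_2},
         torsion_class (v - p *: z))
    & (forall p : {poly 'F_2}, torsion_class (p *: z) -> p = 0)].
End HomologyModTorsion.

(* The other component of the degree of the generator is unconstrained. *)
Definition knot_homology (C : complex) : Prop :=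
  (exists z, (exists b : int, row_homog_mod_U (@gr C) z (0, b)) /\
     free_generator_mod_torsion (map_mx mod_U (diff C)) z) /\
  (exists z, (exists a : int, row_homog_mod_V (@gr C) z (a, 0)) /\
     free_generator_mod_torsion (map_mx mod_V (diff C)) z).

Definition knot_floer_like (C : complex) : Prop :=
  homotopy_equiv C (bar C) /\ knot_homology C.

(* The differential  z_i |-> \sum_j c_ij U^(r_i - r_j) V^(t_i - t_j) z_j  where
   (r_i, t_i) = pos i.  The exponents are meaningful only when c_ij = 0 or
   r_i >= r_j and t_i >= t_j. *)
Definition translate_diff n (pos : 'I_n -> int * int) (c : 'M['F_2]_n) :
    'M[F2UV]_n :=
  \matrix_(i, j) ((c i j)%:P%:P * U ^+ `|(pos i).1 - (pos j).1|%N
                                * V ^+ `|(pos i).2 - (pos j).2|%N).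

(* "Of the form C (x)_F F[U,V] with C finitely generated over F".  The rows of
   P are the elements z_i of the new homogeneous basis. *)
Definition tensor_form (E : complex) : Prop :=
  exists (grz : 'I_(rk E) -> bidegree) (P : 'M[F2UV]_(rk E))
         (pos : 'I_(rk E) -> int * int) (c : 'M['F_2]_(rk E)),
    [/\ P \in unitmx,
        mx_homog 0 grz (@gr E) P,
        (forall i j, c i j != 0 ->
           (pos j).1 <= (pos i).1 /\ (pos j).2 <= (pos i).2)
      & P *m diff E = translate_diff pos c *m P].

Inductive gen :=
  gx | gx' | gx0 | gx1 | gx2 | gx3 | gx4 | gy1 | gy2 | gy3 | gy4
| gp1 | gp2 | gp3 | gp4 | gq1 | gq2 | gq3 | gq4 | gh | gk.

Definition gens : seq gen :=
  [:: gx; gx'; gx0; gx1; gx2; gx3; gx4; gy1; gy2; gy3; gy4;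
      gp1; gp2; gp3; gp4; gq1; gq2; gq3; gq4; gh; gk].

Definition gen_at (i : 'I_21) : gen := nth gx gens i.

Definition gen_idx (g : gen) : 'I_21 :=
  match g with
  | gx => @Ordinal 21 0 isT   | gx' => @Ordinal 21 1 isT
  | gx0 => @Ordinal 21 2 isT  | gx1 => @Ordinal 21 3 isT
  | gx2 => @Ordinal 21 4 isT  | gx3 => @Ordinal 21 5 isT
  | gx4 => @Ordinal 21 6 isT  | gy1 => @Ordinal 21 7 isT
  | gy2 => @Ordinal 21 8 isT  | gy3 => @Ordinal 21 9 isT
  | gy4 => @Ordinal 21 10 isT | gp1 => @Ordinal 21 11 isT
  | gp2 => @Ordinal 21 12 isT | gp3 => @Ordinal 21 13 isT
  | gp4 => @Ordinal 21 14 isT | gq1 => @Ordinal 21 15 isT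
  | gq2 => @Ordinal 21 16 isT | gq3 => @Ordinal 21 17 isT
  | gq4 => @Ordinal 21 18 isT | gh => @Ordinal 21 19 isT
  | gk => @Ordinal 21 20 isT
  end.

Lemma gen_idxK : cancel gen_idx gen_at. Proof. by case. Qed.

Lemma gen_atK : cancel gen_at gen_idx.
Proof. by move=> i; apply/val_inj; case: i; do 21?[case=> //]. Qed.

(* The monomial U^a V^b times the generator g. *)
Definition mon (a b : nat) (g : gen) : 'rV[F2UV]_21 :=
  (U ^+ a * V ^+ b) *: delta_mx 0 (gen_idx g).

Definition D_bd (g : gen) : 'rV[F2UV]_21 :=
  match g with
  | gx | gx' | gx1 | gy1 => 0
  | gp1 => mon 0 4 gx
  | gx4 => mon 1 3 gx
  | gx3 => mon 0 2 gx4 + mon 1 1 gp1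
  | gp2 => mon 2 0 gp1 + mon 1 1 gx4
  | gp3 => mon 0 2 gp2 + mon 1 1 gx3
  | gx2 => mon 0 3 gx1 + mon 2 0 gx3 + mon 1 1 gp2
  | gp4 => mon 5 0 gx + mon 1 1 gy1 + mon 2 3 gx'
  | gh => mon 4 0 gp3 + mon 0 5 gp4 + mon 3 1 gx2 + mon 1 4 gx0
  | gx0 => mon 2 0 gx1 + mon 0 2 gy1 + mon 4 1 gx + mon 1 4 gx'
  | gq1 => mon 4 0 gx'
  | gy4 => mon 3 1 gx'
  | gy3 => mon 2 0 gy4 + mon 1 1 gq1
  | gq2 => mon 0 2 gq1 + mon 1 1 gy4
  | gq3 => mon 2 0 gq2 + mon 1 1 gy3
  | gy2 => mon 3 0 gy1 + mon 0 2 gy3 + mon 1 1 gq2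
  | gq4 => mon 0 5 gx' + mon 1 1 gx1 + mon 3 2 gx
  | gk => mon 0 4 gq3 + mon 5 0 gq4 + mon 1 3 gy2 + mon 4 1 gx0
  end.

(* Determined by D_bd and the value at x_4: see D_gr_unique. *)
Definition D_gr_gen (g : gen) : bidegree :=
  match g with
  | gx => (11, 5)    | gx' => (5, 11)
  | gx0 => (4, 4)
  | gx1 => (7, 3)    | gy1 => (3, 7)
  | gx2 => (8, -2)   | gy2 => (-2, 8)
  | gx3 => (11, -3)  | gy3 => (-3, 11)
  | gx4 => (10, 0)   | gy4 => (0, 10)
  | gp1 => (12, -2)  | gq1 => (-2, 12)
  | gp2 => (9, -1)   | gq2 => (-1, 9)
  | gp3 => (10, -4)  | gq3 => (-4, 10)
  | gp4 => (2, 6)    | gq4 => (6, 2)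
  | gh => (3, -3)    | gk => (-3, 3)
  end.

Definition D_gr (i : 'I_21) : bidegree := D_gr_gen (gen_at i).
Definition D_diff : 'M[F2UV]_21 := \matrix_(i < 21) D_bd (gen_at i).

Lemma coef_UV a b i j :
  (U ^+ a * V ^+ b : F2UV)`_i`_j = ((i == a) && (j == b))%:R.
Proof.
rewrite /U /V -rmorphXn /= coefMC coefXn -mulr_natl.
by case: (i == a); rewrite ?mulr1 ?mul1r ?mul0r ?mulr0 ?coef0 //= coefXn.
Qed.

Lemma coef_mon a b g i c d :
  (mon a b g 0 i)`_c`_d = ((i == gen_idx g) && ((c == a) && (d == b)))%:R.
Proof.
rewrite /mon !mxE eqxx /=; case: (i == gen_idx g); last by rewrite mulr0 !coef0.
by rewrite mulr1 coef_UV.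
Qed.

Lemma coef_rowD n (u v : 'rV[F2UV]_n) k a b :
  ((u + v) 0 k)`_a`_b = (u 0 k)`_a`_b + (v 0 k)`_a`_b.
Proof. by rewrite mxE !coefD. Qed.

Lemma homog_UV a b : homog (- (2 * a)%:Z, - (2 * b)%:Z) (U ^+ a * V ^+ b).
Proof.
move=> i j; rewrite coef_UV.
by have [->|_] := eqVneq i a; have [->|_] := eqVneq j b; rewrite ?eqxx.
Qed.

Lemma row_homogD n (g : 'I_n -> bidegree) u v e :
  row_homog g u e -> row_homog g v e -> row_homog g (u + v) e.
Proof.
move=> hu hv j a b; rewrite coef_rowD => nz.
have [z|nzu] := eqVneq ((u 0 j)`_a`_b) 0; last exact: hu nzu.
by apply: hv; move: nz; rewrite z add0r.
Qed.

Lemma row_homog_mon a b g e :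
    e = D_gr_gen g + (- (2 * a)%:Z, - (2 * b)%:Z) ->
  row_homog D_gr (mon a b g) e.
Proof.
move=> -> j; rewrite /mon !mxE /=; have [->|] := eqVneq j (gen_idx g).
  by rewrite mulr1 /D_gr gen_idxK addrAC subrr add0r; apply: homog_UV.
by move=> _ i k; rewrite mulr0 !coef0 eqxx.
Qed.

Lemma D_diff_homog : mx_homog (-1, -1) D_gr D_gr D_diff.
Proof.
move=> i; rewrite rowK /D_gr; case: (gen_at i) => /=;
  by [move=> j a b; rewrite mxE !coef0 eqxx
     | repeat match goal with |- row_homog _ (_ + _) _ => apply: row_homogD end;
       apply: row_homog_mon].
Qed.

Lemma mon_D_diff a b g :
  mon a b g *m D_diff = (U ^+ a * V ^+ b) *: D_bd g.
Proof. by rewrite -scalemxAl -rowE rowK gen_idxK. Qed.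

Lemma addF2UV (p : F2UV) : p + p = 0.
Proof.
by apply/polyP=> i; apply/polyP=> j; rewrite !coefD !coef0 addrr_pchar2 // pchar_Fp.
Qed.

Lemma mulUV_mon a b c d g :
  (U ^+ a * V ^+ b) *: mon c d g = mon (a + c) (b + d) g.
Proof. by rewrite /mon scalerA mulrACA -!exprD. Qed.

Local Ltac reorder := rewrite /=;
  repeat match goal with |- context [mon ?a ?b ?g] =>
    generalize (mon a b g) end;
  intros; apply/rowP=> j; rewrite !mxE; ring.

Lemma D_diff_sq0 : D_diff *m D_diff = 0.
Proof.
have half (t s : 'rV[F2UV]_21) : s = t + t -> s = 0.
  by move=> ->; apply/rowP=> j; rewrite !mxE addF2UV.
have expand := (scalerDr, mulUV_mon, addSn, add0n).
apply/row_matrixP=> i; rewrite row_mul rowK row0.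
case: (gen_at i); rewrite /D_bd ?mul0mx // ?mulmxDl ?mon_D_diff /D_bd
  ?scaler0 ?addr0 // !expand ?scaler0 ?add0r.
- by apply: (half (mon 2 2 gx4 + mon 3 1 gp1)); reorder.
- by apply: (half (mon 1 5 gx)); reorder.
- by apply: (half (mon 2 2 gy4 + mon 1 3 gq1)); reorder.
- by apply: (half (mon 5 1 gx')); reorder.
- by apply: (half (mon 2 4 gx)); reorder.
- by apply: (half (mon 2 2 gp1 + mon 1 3 gx4)); reorder.
- by apply: (half (mon 4 2 gx')); reorder.
- by apply: (half (mon 2 2 gq1 + mon 3 1 gy4)); reorder.
- by apply: (half (mon 4 2 gp2 + mon 5 1 gx3 + mon 5 5 gx + mon 1 6 gy1
    + mon 2 8 gx' + mon 3 4 gx1)); reorder.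
- by apply: (half (mon 2 4 gq2 + mon 1 5 gy3 + mon 5 5 gx' + mon 6 1 gx1
    + mon 8 2 gx + mon 4 3 gy1)); reorder.
Qed.

Definition D : complex := Complex D_diff_homog D_diff_sq0.

Local Ltac entry := rewrite /D_bd ?coef_rowD !coef_mon; exact: isT.

Lemma D_gr_unique (g : 'I_21 -> bidegree) :
  mx_homog (-1, -1) g g D_diff -> g (gen_idx gx4) = (10, 0) ->
  forall i, g i = D_gr i.
Proof.
move=> hg g4.
have edge s t a b : ((D_bd s) 0 (gen_idx t))`_a`_b != 0 ->
    g (gen_idx s) + (-1, -1) - g (gen_idx t) = (- (2 * a)%:Z, - (2 * b)%:Z).
  by move=> nz; apply: (hg (gen_idx s) (gen_idx t)); rewrite rowK gen_idxK.
have down s t a b : ((D_bd s) 0 (gen_idx t))`_a`_b != 0 ->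
    g (gen_idx s) = D_gr_gen s ->
    D_gr_gen s + (-1, -1) - D_gr_gen t = (- (2 * a)%:Z, - (2 * b)%:Z) ->
    g (gen_idx t) = D_gr_gen t.
  by move=> /edge h h1; move: h; rewrite h1 => <- /addrI/oppr_inj.
have up s t a b : ((D_bd s) 0 (gen_idx t))`_a`_b != 0 ->
    g (gen_idx t) = D_gr_gen t ->
    D_gr_gen s + (-1, -1) - D_gr_gen t = (- (2 * a)%:Z, - (2 * b)%:Z) ->
    g (gen_idx s) = D_gr_gen s.
  by move=> /edge h h1; move: h; rewrite h1 => <- /addIr/addIr.
have e_x : g (gen_idx gx) = D_gr_gen gx.
  apply: (down gx4 gx 1 3); [entry | by [] | by []].
have e_p1 : g (gen_idx gp1) = D_gr_gen gp1.
  apply: (up gp1 gx 0 4); [entry | by [] | by []].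
have e_x3 : g (gen_idx gx3) = D_gr_gen gx3.
  apply: (up gx3 gx4 0 2); [entry | by [] | by []].
have e_p2 : g (gen_idx gp2) = D_gr_gen gp2.
  apply: (up gp2 gp1 2 0); [entry | by [] | by []].
have e_p3 : g (gen_idx gp3) = D_gr_gen gp3.
  apply: (up gp3 gp2 0 2); [entry | by [] | by []].
have e_x2 : g (gen_idx gx2) = D_gr_gen gx2.
  apply: (up gx2 gx3 2 0); [entry | by [] | by []].
have e_x1 : g (gen_idx gx1) = D_gr_gen gx1.
  apply: (down gx2 gx1 0 3); [entry | by [] | by []].
have e_x0 : g (gen_idx gx0) = D_gr_gen gx0.
  apply: (up gx0 gx1 2 0); [entry | by [] | by []].
have e_y1 : g (gen_idx gy1) = D_gr_gen gy1.
  apply: (down gx0 gy1 0 2); [entry | by [] | by []].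
have e_x' : g (gen_idx gx') = D_gr_gen gx'.
  apply: (down gx0 gx' 1 4); [entry | by [] | by []].
have e_p4 : g (gen_idx gp4) = D_gr_gen gp4.
  apply: (up gp4 gx 5 0); [entry | by [] | by []].
have e_h : g (gen_idx gh) = D_gr_gen gh.
  apply: (up gh gp3 4 0); [entry | by [] | by []].
have e_q1 : g (gen_idx gq1) = D_gr_gen gq1.
  apply: (up gq1 gx' 4 0); [entry | by [] | by []].
have e_y4 : g (gen_idx gy4) = D_gr_gen gy4.
  apply: (up gy4 gx' 3 1); [entry | by [] | by []].
have e_y3 : g (gen_idx gy3) = D_gr_gen gy3.
  apply: (up gy3 gy4 2 0); [entry | by [] | by []].
have e_q2 : g (gen_idx gq2) = D_gr_gen gq2.
  apply: (up gq2 gq1 0 2); [entry | by [] | by []].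
have e_q3 : g (gen_idx gq3) = D_gr_gen gq3.
  apply: (up gq3 gq2 2 0); [entry | by [] | by []].
have e_y2 : g (gen_idx gy2) = D_gr_gen gy2.
  apply: (up gy2 gy1 3 0); [entry | by [] | by []].
have e_q4 : g (gen_idx gq4) = D_gr_gen gq4.
  apply: (up gq4 gx' 0 5); [entry | by [] | by []].
have e_k : g (gen_idx gk) = D_gr_gen gk.
  apply: (up gk gq3 0 4); [entry | by [] | by []].
by move=> i; rewrite /D_gr -[i in LHS]gen_atK; case: (gen_at i).
Qed.

(* Main.v *)
(* A complex E of tensor form carries a weight, the homological degree of the
   underlying F-complex, which U and V preserve and the differential lowers by
   one. If D were homotopy equivalent to E, the projections of E onto weights at
   most m would transfer to degree-0 endomorphisms Q_m of D with
   Q_m d = d Q_(m-1), where Q_m is homotopic to 1 for large m and Q_m = 0 for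
   small m. The bidegrees of the generators of D are distinct, and for suitable
   arrows s -> t no degree-0 map can interfere, so the diagonal entries satisfy
   q_m(s) = q_(m-1)(t). Along the chain
     x <- p4 -> y1 <- x0 -> x1 <- x2 -> x3 -> x4 -> x
   this gives q_m(x) = q_(m-2)(x) for all m, but q_m(x) is 1 for large m and 0
   for small m. *)
Require Import Defs.
From HB Require Import structures.
From mathcomp Require Import all_boot all_order all_algebra.
From mathcomp Require Import perm zify.

Set Implicit Arguments.
Unset Strict Implicit.
Unset Printing Implicit Defensive.

Import Order.TTheory GRing.Theory Num.Theory.
Local Open Scope ring_scope.

(** * Homogeneous parts and graded matrices *)

Definition deg (a b : nat) : bidegree := (- (2 * a)%:Z, - (2 * b)%:Z).

Lemma degD a b c d : deg (a + c) (b + d) = deg a b + deg c d.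
Proof. by apply/eqP/andP; split; apply/eqP => /=; lia. Qed.

(** Recasts homogeneity as the equation [hpart e p = p], so that closure properties follow from how
    [hpart] acts on sums and products. *)
Definition hpart (e : bidegree) (p : F2UV) : F2UV :=
  \poly_(a < size p) \poly_(b < size p`_a)
    (if e == deg a b then p`_a`_b else 0).

Lemma coef_hpart e p a b :
  (hpart e p)`_a`_b = if e == deg a b then p`_a`_b else 0.
Proof.
rewrite /hpart coef_poly; case: ltnP => [_|sp].
  rewrite coef_poly; case: ltnP => // sb.
  by rewrite (nth_default 0 sb) if_same.
by rewrite !(nth_default 0 sp) !coef0 if_same.
Qed.

Lemma polyXY_eq (p q : F2UV) : (forall a b, p`_a`_b = q`_a`_b) -> p = q.
Proof. by move=> pq; apply/polyP=> a; apply/polyP=> b. Qed.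

Lemma hpart_id e p : homog e p <-> hpart e p = p.
Proof.
split=> [hp|<- a b].
  apply: polyXY_eq => a b; rewrite coef_hpart; case: eqP => // ne.
  by apply/esym/eqP/negP=> /negP /hp.
by rewrite coef_hpart; case: (e =P _) => [-> //|_]; rewrite eqxx.
Qed.

Lemma hpart_homog e p : homog e (hpart e p).
Proof. by move=> a b; rewrite coef_hpart; case: (e =P _) => [-> //|_]; rewrite eqxx. Qed.

Lemma hpart_sum e (I : finType) (p : I -> F2UV) :
  hpart e (\sum_i p i) = \sum_i hpart e (p i).
Proof.
apply: polyXY_eq => a b; rewrite coef_hpart !coef_sum.
under [RHS]eq_bigr do rewrite coef_hpart.
by case: eqP => // _; rewrite big1.
Qed.

Lemma hpartM e1 e2 p q : homog e2 q -> hpart (e1 + e2) (p * q) = hpart e1 p * q.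
Proof.
move=> hq; apply: polyXY_eq => a b.
rewrite coef_hpart !coefM !coef_sum -[RHS]/(\sum_(i < a.+1) _).
have -> : \sum_(i < a.+1) ((hpart e1 p)`_i * q`_(a - i))`_b =
    \sum_(i < a.+1) (if e1 + e2 == deg a b then (p`_i * q`_(a - i))`_b else 0).
  apply: eq_bigr => i _; rewrite !coefM.
  have -> : (if e1 + e2 == deg a b
      then \sum_(j < b.+1) p`_i`_j * q`_(a - i)`_(b - j) else 0) =
    \sum_(j < b.+1)
      (if e1 + e2 == deg a b then p`_i`_j * q`_(a - i)`_(b - j) else 0).
    by case: eqP => // _; rewrite big1.
  apply: eq_bigr => j _; rewrite coef_hpart.
  (* Where this coefficient of [q] is nonzero, [e2] is its bidegree, and additivity of [deg] turns
     the test on [e1 + e2] into one on [e1]. *)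
  have [->|/hq e2E] := eqVneq (q`_(a - i)`_(b - j)) 0.
    by rewrite !mulr0 if_same.
  have -> : (e1 + e2 == deg a b) = (e1 == deg i j).
    rewrite -[deg a b](_ : deg i j + e2 = _) ?(can_eq (addrK _)) //.
    rewrite e2E -[(_, _)]/(deg _ _) -degD.
    by have := ltn_ord i; have := ltn_ord j; rewrite !ltnS => ? ?; rewrite !subnKC.
  by case: eqP => // _; rewrite mul0r.
by case: eqP => // _; rewrite big1.
Qed.

Lemma homogM e1 e2 p q : homog e1 p -> homog e2 q -> homog (e1 + e2) (p * q).
Proof. by move=> /hpart_id hp hq; apply/hpart_id; rewrite hpartM ?hp. Qed.

Lemma homog_sum e (I : finType) (p : I -> F2UV) :
  (forall i, homog e (p i)) -> homog e (\sum_i p i).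
Proof.
by move=> hp; apply/hpart_id; rewrite hpart_sum; apply: eq_bigr => i _; apply/hpart_id.
Qed.

Lemma homog0 e : homog e 0.
Proof. by move=> a b; rewrite !coef0 eqxx. Qed.

Lemma homog1 : homog 0 1.
Proof.
by move=> a b; rewrite coef1; case: a => [|a]; rewrite ?coef1 ?coef0 //; case: b.
Qed.

Lemma homog_nz e p : homog e p -> p != 0 -> e.1 <= 0 /\ e.2 <= 0.
Proof.
move=> hp nz; apply/andP; apply: contraR nz => ne.
apply/eqP/polyXY_eq => a b; rewrite !coef0.
by apply/eqP; apply: contraR ne => /hp -> /=; lia.
Qed.

Lemma mx_homogP m n e gr gr' (A : 'M[F2UV]_(m, n)) :
  mx_homog e gr gr' A <-> (forall i j, homog (gr i + e - gr' j) (A i j)).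
Proof. by split=> hA i j; have := hA i j; rewrite mxE. Qed.

Lemma mx_homogM m n k e e' gr gr' gr''
    (A : 'M[F2UV]_(m, n)) (B : 'M[F2UV]_(n, k)) :
  mx_homog e gr gr' A -> mx_homog e' gr' gr'' B ->
  mx_homog (e + e') gr gr'' (A *m B).
Proof.
move=> /mx_homogP hA /mx_homogP hB; apply/mx_homogP => i j.
rewrite mxE; apply: homog_sum => l.
have -> : gr i + (e + e') - gr'' j = (gr i + e - gr' l) + (gr' l + e' - gr'' j).
  by rewrite !addrA subrK.
exact: homogM.
Qed.

Lemma mx_homog0M m n k gr gr' gr'' (A : 'M[F2UV]_(m, n)) (B : 'M[F2UV]_(n, k)) :
  mx_homog 0 gr gr' A -> mx_homog 0 gr' gr'' B -> mx_homog 0 gr gr'' (A *m B).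
Proof.
by rewrite -[X in _ -> _ -> mx_homog X _ _ _](addr0 (0 : bidegree)); apply: mx_homogM.
Qed.

Lemma mx_homog_diag n gr (d : 'rV[F2UV]_n) :
  (forall i, homog 0 (d 0 i)) -> mx_homog 0 gr gr (diag_mx d).
Proof.
move=> hd; apply/mx_homogP => i j; rewrite mxE.
by have [->|_] := eqVneq; rewrite ?addr0 ?subrr ?mulr1n //; apply: homog0.
Qed.

(** The homogeneous part [Q] of the inverse is still a left inverse, as seen by taking components in
    [invmx P *m P = 1]; uniqueness of inverses gives [Q = invmx P]. *)
Lemma mx_homog_inv n gr gr' (P : 'M[F2UV]_n) :
  P \in unitmx -> mx_homog 0 gr gr' P -> mx_homog 0 gr' gr (invmx P).
Proof.
move=> uP /mx_homogP hP.
pose Q := \matrix_(i, j) hpart (gr' i - gr j) (invmx P i j).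
suff <- : Q = invmx P.
  by apply/mx_homogP => i j; rewrite mxE addr0; apply: hpart_homog.
suff QP : Q *m P = 1%:M by rewrite -[Q]mulmx1 -(mulmxV uP) mulmxA QP mul1mx.
apply/matrixP => i k; rewrite mxE.
have := congr1 (fun A : 'M_n => hpart (gr' i - gr' k) (A i k)) (mulVmx uP).
rewrite mxE hpart_sum => E.
transitivity (hpart (gr' i - gr' k) ((1%:M : 'M[F2UV]_n) i k)); last first.
  apply/hpart_id; rewrite mxE; have [->|_] := eqVneq; last exact: homog0.
  by rewrite subrr; apply: homog1.
rewrite -E; apply: eq_bigr => j _; rewrite mxE.
rewrite -[X in _ = hpart X _](subrKA (gr j)) hpartM //.
by have := hP j k; rewrite addr0.
Qed.

(** * Weights on complexes of tensor form *)

(* The weight of z_i is the homological degree of the generator of C, obtained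
   from the bidegree by undoing the factors U^(r_i): U and V preserve it and
   the differential lowers it by one. *)
Lemma tensor_form_weight (E : complex) : tensor_form E ->
  exists (P : 'M[F2UV]_(rk E)) (grz : 'I_(rk E) -> bidegree)
         (M : 'I_(rk E) -> int),
    [/\ P \in unitmx, mx_homog 0 grz (@gr E) P
      & forall i j, (P *m diff E *m invmx P) i j != 0 -> M i = M j + 1].
Proof.
case=> grz [P [pos [c [uP hP cpos eqP]]]].
exists P, grz, (fun i => (grz i).1 + 2 * (pos i).1); split=> // i j.
have hT : mx_homog (-1, -1) grz grz (P *m diff E *m invmx P).
  rewrite -[(-1, -1)](addr0 ((-1, -1) : bidegree)).
  apply: (mx_homogM _ (mx_homog_inv uP hP)).
  rewrite -[(-1, -1)](add0r ((-1, -1) : bidegree)).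
  exact: mx_homogM hP (@diff_homog E).
have := hT i j; rewrite mxE eqP mulmxK // mxE => hij nz.
have cn : c i j != 0.
  by apply: contraNneq nz => ->; rewrite !rmorph0 !mul0r.
have [le1 le2] := cpos i j cn.
(* The entry is [c i j] times U^(r_i - r_j) V^(t_i - t_j); its degree gives gr_U z_i - 1 - gr_U z_j
   = -2 (r_i - r_j), where [le1] removes the absolute value. *)
have := hij `|(pos i).1 - (pos j).1|%N `|(pos i).2 - (pos j).2|%N.
rewrite -mulrA coefCM coefCM coef_UV !eqxx mulr1 => /(_ cn).
case: (grz i) (grz j) => [a b] [a' b'] /= [e1 _]; lia.
Qed.
(** Over F_2 a nonzero homogeneous polynomial is a monomial, so evaluation at U = V = 1 detects it;
    being a ring morphism, it turns matrix identities into scalar ones. *)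
Definition ev (p : F2UV) : 'F_2 := p.[1].[1].
HB.instance Definition _ :=
  GRing.RMorphism.copy ev (horner_eval 1 \o horner_eval (1 : {poly 'F_2})).

Lemma evU : ev U = 1.
Proof. by rewrite /ev /U hornerX hornerC. Qed.

Lemma evV : ev V = 1.
Proof. by rewrite /ev /V hornerC hornerX. Qed.

Lemma evM p q : ev (p * q) = ev p * ev q.
Proof. exact: rmorphM. Qed.

Lemma ev_nz e p : homog e p -> ev p != 0 -> e.1 <= 0 /\ e.2 <= 0.
Proof.
by move=> hp nz; apply: homog_nz hp _; apply: contraNneq nz => ->; rewrite rmorph0.
Qed.

(** * Truncation by weight *)

Section Projections.
Variables (C E : complex) (f : 'M[F2UV]_(rk C, rk E)) (g : 'M[F2UV]_(rk E, rk C)).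
Hypotheses (hf : chain_map f) (hg : chain_map g) (tE : tensor_form E).

(* The witness is Q m = f, then the projection onto weights at most m, then g. *)
Lemma weight_filtration :
  exists Q : int -> 'M[F2UV]_(rk C),
    [/\ forall m, mx_homog 0 (@gr C) (@gr C) (Q m),
        forall m, Q (m + 1) *m diff C = diff C *m Q m
      & exists B : nat, forall m : int,
          (B%:Z <= m -> Q m = f *m g) /\ (m < - B%:Z -> Q m = 0)].
Proof.
have [P [grz [M [uP hP MT]]]] := tensor_form_weight tE.
have [[hf0 df] [hg0 dg]] := (hf, hg).
pose T := P *m diff E *m invmx P.
pose pr m := diag_mx (\row_i ((M i <= m)%R%:R : F2UV)).
(* Where [T i j] is nonzero, [M i = M j + 1], so [M i <= m + 1] exactly when [M j <= m]. *)
have prT m : pr (m + 1) *m T = T *m pr m.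
  move: (T) (MT : forall i j, T i j != 0 -> _) => {MT} S MS.
  apply/matrixP => i j; rewrite mul_diag_mx mul_mx_diag !mxE [RHS]mulrC.
  have [->|/MS ->] := eqVneq (S i j) 0; first by rewrite !mulr0.
  by rewrite lerD2r.
exists (fun m => f *m (invmx P *m pr m *m P) *m g); split=> [m|m|].
- apply: (mx_homog0M _ hg0); apply: (mx_homog0M hf0).
  apply: (mx_homog0M _ hP); apply: (mx_homog0M (mx_homog_inv uP hP)).
  apply: mx_homog_diag => i; rewrite mxE; case: (_ <= _); [exact: homog1 | exact: homog0].
- have -> : diff C *m (f *m (invmx P *m pr m *m P) *m g) =
      f *m (diff E *m (invmx P *m pr m *m P)) *m g by rewrite !mulmxA df.
  have -> : f *m (invmx P *m pr (m + 1) *m P) *m g *m diff C =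
      f *m ((invmx P *m pr (m + 1) *m P) *m diff E) *m g.
    by rewrite -!mulmxA dg.
  congr (_ *m _ *m _).
  have PE : P *m diff E = T *m P by rewrite /T mulmxKV.
  rewrite -mulmxA PE mulmxA -(mulmxA (invmx P)) prT !mulmxA.
  by rewrite mulVmx // mul1mx.
(* All weights lie between [-B] and [B]; the condition [m < - B] is strict because weight [-B] may
   occur. *)
- exists (\max_i `|M i|)%N => m.
  have bM i : (`|M i| <= \max_i `|M i|)%N by apply: leq_bigmax.
  split=> hm.
    have -> : pr m = 1%:M.
      rewrite /pr -diag_const_mx; congr diag_mx; apply/rowP => i; rewrite !mxE.
      by have -> : M i <= m by have := bM i; lia.
    by rewrite mulmx1 mulVmx // mulmx1.
  have -> : pr m = 0.
    apply/matrixP => i j; rewrite !mxE.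
    have -> : (M i <= m) = false by have := bM i; lia.
    by rewrite mul0rn.
  by rewrite mulmx0 !mul0mx mulmx0 mul0mx.
Qed.
End Projections.

(** * Rigid arrows of D *)

(* (a, b, g) stands for the term U^a V^b g of the differential. *)
Definition terms (s : gen) : seq (nat * nat * gen) :=
  match s with
  | gx | gx' | gx1 | gy1 => [::]
  | gp1 => [:: (0, 4, gx)]
  | gx4 => [:: (1, 3, gx)]
  | gx3 => [:: (0, 2, gx4); (1, 1, gp1)]
  | gp2 => [:: (2, 0, gp1); (1, 1, gx4)]
  | gp3 => [:: (0, 2, gp2); (1, 1, gx3)]
  | gx2 => [:: (0, 3, gx1); (2, 0, gx3); (1, 1, gp2)]
  | gp4 => [:: (5, 0, gx); (1, 1, gy1); (2, 3, gx')]
  | gh => [:: (4, 0, gp3); (0, 5, gp4); (3, 1, gx2); (1, 4, gx0)]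
  | gx0 => [:: (2, 0, gx1); (0, 2, gy1); (4, 1, gx); (1, 4, gx')]
  | gq1 => [:: (4, 0, gx')]
  | gy4 => [:: (3, 1, gx')]
  | gy3 => [:: (2, 0, gy4); (1, 1, gq1)]
  | gq2 => [:: (0, 2, gq1); (1, 1, gy4)]
  | gq3 => [:: (2, 0, gq2); (1, 1, gy3)]
  | gy2 => [:: (3, 0, gy1); (0, 2, gy3); (1, 1, gq2)]
  | gq4 => [:: (0, 5, gx'); (1, 1, gx1); (3, 2, gx)]
  | gk => [:: (0, 4, gq3); (5, 0, gq4); (1, 3, gy2); (4, 1, gx0)]
  end%N.

Lemma D_diffE s j :
  D_diff (gen_idx s) j =
  \sum_(m <- terms s) (U ^+ m.1.1 * V ^+ m.1.2) *+ (j == gen_idx m.2).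
Proof.
have -> : D_diff (gen_idx s) j = (\sum_(m <- terms s) mon m.1.1 m.1.2 m.2) 0 j.
  by rewrite mxE gen_idxK; congr (_ _ j);
     case: s; rewrite /D_bd /terms ?big_cons big_nil /= ?addr0 ?addrA.
by rewrite summxE; apply: eq_bigr => m _; rewrite !mxE eqxx mulr_natr.
Qed.

Definition arrows (s t : gen) : nat :=
  count (fun m => gen_idx t == gen_idx m.2) (terms s).

Lemma ev_D_diff s t : ev (D_diff (gen_idx s) (gen_idx t)) = (arrows s t)%:R.
Proof.
rewrite D_diffE rmorph_sum /arrows -sum1_count natr_sum [RHS]big_mkcond.
apply: eq_bigr => m _; rewrite rmorphMn rmorphM !rmorphXn.
by rewrite /= evU evV !expr1n mulr1; case: eqP.
Qed.

Definition gle (e e' : bidegree) : bool := (e.1 <= e'.1) && (e.2 <= e'.2).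

(** The two clauses forbid detours from [s] to [t]: a degree-0 map followed by an arrow, and an
    arrow followed by a degree-0 map. Phrased with [gle] and counts, they can be checked by
    computation. *)
Definition rigid (s t : gen) : Prop :=
  arrows s t = 1%N /\
  forall u,
    (gen_idx u != gen_idx s -> gle (D_gr_gen s) (D_gr_gen u) -> arrows u t = 0%N)
 /\ (gen_idx u != gen_idx t -> gle (D_gr_gen u) (D_gr_gen t) -> arrows s u = 0%N).

Lemma ev_nz_gle (Q : 'M[F2UV]_21) s t :
  mx_homog 0 D_gr D_gr Q -> ev (Q (gen_idx s) (gen_idx t)) != 0 ->
  gle (D_gr_gen s) (D_gr_gen t).
Proof.
move=> /mx_homogP/(_ (gen_idx s) (gen_idx t)) hQ /(ev_nz hQ).
rewrite /D_gr !gen_idxK addr0 /gle /= => -[le1 le2].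
by rewrite -subr_le0 le1 -subr_le0 le2.
Qed.

(* No degree-0 map can route a rigid arrow through a third generator. *)
Lemma rigid_diag (Q Q' : 'M[F2UV]_21) s t :
  mx_homog 0 D_gr D_gr Q -> mx_homog 0 D_gr D_gr Q' ->
  Q *m D_diff = D_diff *m Q' -> rigid s t ->
  ev (Q (gen_idx s) (gen_idx s)) = ev (Q' (gen_idx t) (gen_idx t)).
Proof.
move=> hQ hQ' E [st hu].
have := congr1 (fun A : 'M_21 => ev (A (gen_idx s) (gen_idx t))) E.
(* Only the summands through [s] on the left and through [t] on the right survive; rigidity kills
   the rest. *)
rewrite !mxE !rmorph_sum /= (bigD1 (gen_idx s)) //= [in RHS](bigD1 (gen_idx t)) //=.
rewrite !evM ev_D_diff st mulr1 mul1r.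
rewrite big1 => [|u nu]; last first.
  rewrite -[u]gen_atK in nu *; have [hL _] := hu (gen_at u).
  rewrite evM ev_D_diff.
  case: (eqVneq (ev (Q (gen_idx s) (gen_idx (gen_at u)))) 0) => [->|nz].
    by rewrite mul0r.
  have le := ev_nz_gle hQ nz.
  by rewrite hL ?mulr0.
rewrite big1 => [|u nu]; last first.
  rewrite -[u]gen_atK in nu *; have [_ hR] := hu (gen_at u).
  rewrite evM ev_D_diff.
  case: (eqVneq (ev (Q' (gen_idx (gen_at u)) (gen_idx t))) 0) => [->|nz].
    by rewrite mulr0.
  have le := ev_nz_gle hQ' nz.
  by rewrite hR ?mul0r.
by rewrite !addr0.
Qed.

(** * The obstruction to tensor form *)

Lemma D_not_tensor_form (E : complex) : tensor_form E -> ~ homotopy_equiv D E.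
Proof.
move=> tE [f [g [hf hg [H [hH fgE]] _]]].
have [Q [hQ dQ [B QB]]] := weight_filtration hf hg tE.
pose q (m : int) s := ev (Q m (gen_idx s) (gen_idx s)).
have arrow m s t : rigid s t -> q (m + 1) s = q m t.
  exact: rigid_diag (dQ m).
have step (m : int) : q (m + 2) gx = q m gx.
  have p4x : rigid gp4 gx by split=> //; case.
  have p4y1 : rigid gp4 gy1 by split=> //; case.
  have x0y1 : rigid gx0 gy1 by split=> //; case.
  have x0x1 : rigid gx0 gx1 by split=> //; case.
  have x2x1 : rigid gx2 gx1 by split=> //; case.
  have x2x3 : rigid gx2 gx3 by split=> //; case.
  have x3x4 : rigid gx3 gx4 by split=> //; case.
  have x4x : rigid gx4 gx by split=> //; case.
  have -> : m + 2 = m + 1 + 1 by rewrite -addrA.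
  (* An arrow run backwards raises the index by one, an arrow run forwards lowers it by one; this
     loop has three backward and five forward arrows. *)
  rewrite -(arrow _ _ _ p4x) (arrow _ _ _ p4y1).
  rewrite -(arrow _ _ _ x0y1) (arrow _ _ _ x0x1).
  rewrite -(arrow _ _ _ x2x1) (arrow _ _ _ x2x3).
  by rewrite (arrow _ _ _ x3x4) (arrow _ _ _ x4x).
have stepn (m : int) (n : nat) : q (m + 2 * n%:Z) gx = q m gx.
  elim: n => [|n IH]; first by rewrite mulr0 addr0.
  have -> : m + 2 * n.+1%:Z = m + 2 * n%:Z + 2 by lia.
  by rewrite step.
(* Index [-B - 2] lies below [-B], and [B + 1] steps of length 2 lead from it to exactly [B]. *)
have low : q (- (B%:Z) - 2) gx = 0.
  by rewrite /q (QB _).2 ?mxE ?rmorph0 //; lia.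
have high : q (- (B%:Z) - 2 + 2 * (B + 1)%N%:Z) gx = 1.
  rewrite /q (QB _).1; last by lia.
  (* Both homotopy terms vanish at the diagonal entry of x: one because x is a cycle, the other
     because [H] has degree (1, 1), so a nonzero entry from x to u needs gr u >= (12, 6), which no
     source of an arrow into x satisfies. *)
  have -> : f *m g = 1%:M + D_diff *m H + H *m D_diff.
    by rewrite -addrA -fgE addrC subrK.
  have dx u : ev (D_diff (gen_idx gx) u) = 0.
    by rewrite -[u]gen_atK ev_D_diff.
  pose x := gen_idx gx; rewrite -/x in dx *.
  rewrite !mxE eqxx !rmorphD !rmorph_sum /= big1 => [|u _]; last first.
    by rewrite evM dx mul0r.
  rewrite big1 => [|u _]; first by rewrite rmorph1 !addr0.
  rewrite evM -[u]gen_atK [ev (D_diff _ _)](ev_D_diff _ gx).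
  have /mx_homogP/(_ (gen_idx gx) (gen_idx (gen_at u))) hu := hH.
  case: (eqVneq (ev (H (gen_idx gx) (gen_idx (gen_at u)))) 0) => [->|nz].
    by rewrite mul0r.
  have [] := ev_nz hu nz; rewrite /= /D_gr !gen_idxK.
  by case: (gen_at u) => // *; rewrite mulr0.
by have := stepn (- (B%:Z) - 2) (B + 1)%N; rewrite low high => /eqP.
Qed.

(** * Homology of a differential given by a matching *)

Section Matching.
Variables (n : nat) (d : 'M[{poly 'F_2}]_n) (k : 'I_n).
Variables (s : 'I_n -> 'I_n) (src : pred 'I_n) (ex : 'I_n -> nat) (N : nat).
Hypotheses (sK : involutive s) (srcs : forall i, i != k -> src (s i) = ~~ src i).
Hypotheses (sk : s k = k) (srck : ~~ src k) (exN : forall i, (ex i <= N)%N).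
Hypothesis dE : forall i j, d i j = if src i && (j == s i) then 'X^(ex i) else 0.

Lemma matching_mul (v : 'rV_n) j :
  (v *m d) 0 j = if src (s j) then v 0 (s j) * 'X^(ex (s j)) else 0.
Proof.
rewrite mxE (bigD1 (s j)) //= dE sK eqxx andbT big1 ?addr0; last first.
  move=> i ne; rewrite dE; case: (j =P s i) => [ji|_]; last by rewrite andbF mulr0.
  by rewrite ji sK eqxx in ne.
by case: ifP => _; rewrite ?mulr0.
Qed.

(** A cycle has no source coordinates, so the matched pairs contribute only torsion, killed by
    ['X^N]; the unmatched [k] has coordinate 0 in every boundary. *)
Lemma matching_free_generator :
  free_generator_mod_torsion d (delta_mx 0 k).
Proof.
have Xn0 m : 'X^m != 0 :> {poly 'F_2} by rewrite monic_neq0 ?monicXn.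
split.
- apply/rowP => j; rewrite matching_mul !mxE eqxx /=.
  case: ifP => // sj; have [jk|_] := eqVneq (s j) k; last by rewrite mul0r.
  by rewrite jk (negbTE srck) in sj.
- move=> v cv; exists (v 0 k), N.
  have v0 i : src i -> v 0 i = 0.
    move=> si; have /rowP/(_ (s i)) := cv.
    by rewrite matching_mul sK si mxE => /eqP; rewrite mulf_eq0 (negbTE (Xn0 _)) orbF => /eqP.
  (* The power of ['X] tops up each exponent [ex i] to the uniform [N]. *)
  exists (\row_i if src i then 'X^(N - ex i) * v 0 (s i) else 0).
  apply/rowP => j; rewrite matching_mul !mxE eqxx sK /=.
  have [->|nj] := eqVneq j k; first by rewrite sk (negbTE srck) mulr1 subrr mulr0.
  rewrite srcs // mulr0 subr0; have [/v0->|_] := boolP (src j).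
    by rewrite mulr0 mul0r.
  by rewrite mulrAC -exprD subnK.
- move=> p [m [w /rowP/(_ k)]]; rewrite matching_mul sk (negbTE srck) !mxE !eqxx mulr1.
  by move=> /eqP; rewrite mulf_eq0 (negbTE (Xn0 _)) => /eqP.
Qed.
End Matching.

(** * Symmetry of D *)

Lemma homotopy_equiv_bar (C : complex) (s : {perm 'I_(rk C)}) :
  (forall i, gr (s i) = ((gr i).2, (gr i).1)) ->
  (forall i j, diff C (s i) (s j) = swapXY (diff C i j)) ->
  homotopy_equiv C (bar C).
Proof.
move=> hgr hd; pose f : 'M[F2UV]_(rk C) := perm_mx s.
have uf : f \in unitmx by apply: unitmx_perm.
have hf : mx_homog 0 (@gr C) (@bar_gr C) f.
  apply/mx_homogP => i j; rewrite /f !mxE /bar_gr.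
  have [<-|_] := eqVneq (s i) j; last exact: homog0.
  by rewrite hgr /= -surjective_pairing addr0 subrr; apply: homog1.
have df : diff C *m f = f *m bar_diff C.
  rewrite -row_permE /f -[s in LHS]invgK -col_permE; apply/matrixP => i j.
  by rewrite !mxE -{2}[j](permKV s) hd swapXYK.
(* Permuting the basis is an isomorphism onto [bar C], so both homotopies can be 0. *)
have homotopic0 (E : complex) (A : 'M_(rk E)) :
    A = 1%:M -> @chain_homotopic E E A 1%:M.
  move=> ->; exists 0; split; last by rewrite subrr mulmx0 mul0mx addr0.
  by apply/mx_homogP => i j; rewrite mxE; apply: homog0.
exists f, (invmx f); split.
- by [].
- split; first exact: mx_homog_inv.
  by rewrite /= -[bar_diff C](mulKmx uf) -df -mulmxA mulmxK.
- by apply: homotopic0; rewrite mulmxV.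
- by apply: (homotopic0 (bar C)); rewrite mulVmx.
Qed.

Definition swap (s : gen) : gen :=
  match s with
  | gx => gx' | gx' => gx | gx0 => gx0
  | gx1 => gy1 | gx2 => gy2 | gx3 => gy3 | gx4 => gy4
  | gy1 => gx1 | gy2 => gx2 | gy3 => gx3 | gy4 => gx4
  | gp1 => gq1 | gp2 => gq2 | gp3 => gq3 | gp4 => gq4
  | gq1 => gp1 | gq2 => gp2 | gq3 => gp3 | gq4 => gp4
  | gh => gk | gk => gh
  end.

Lemma swapK : involutive swap. Proof. by case. Qed.

Definition swap_idx (i : 'I_21) : 'I_21 := gen_idx (swap (gen_at i)).

Lemma swap_idxK : involutive swap_idx.
Proof. by move=> i; rewrite /swap_idx gen_idxK swapK gen_atK. Qed.

Lemma swap_idxE s : swap_idx (gen_idx s) = gen_idx (swap s).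
Proof. by rewrite /swap_idx gen_idxK. Qed.

Lemma swapXY_UV a b : swapXY (U ^+ a * V ^+ b : F2UV) = U ^+ b * V ^+ a.
Proof. by rewrite rmorphM !rmorphXn /= /U /V swapXY_X swapXY_Y mulrC. Qed.

Lemma D_diff_swap i j :
  D_diff (swap_idx i) (swap_idx j) = swapXY (D_diff i j).
Proof.
rewrite -[i]gen_atK swap_idxE !D_diffE rmorph_sum /=.
under [RHS]eq_bigr => m _ do rewrite rmorphMn /= swapXY_UV.
have swj s : (swap_idx j == gen_idx s) = (j == gen_idx (swap s)).
  by rewrite -(can_eq swap_idxK) swap_idxK swap_idxE.
case: (gen_at i); rewrite /terms ?big_cons ?big_nil ?swj ?addr0 //.
(* This is [gx0], fixed by [swap]: its terms are exchanged in pairs, so the sums differ only in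
   order. *)
by rewrite [LHS]addrCA [X in _ + (_ + X) = _]addrC.
Qed.

Lemma D_symmetric : homotopy_equiv D (bar D).
Proof.
apply: (@homotopy_equiv_bar D (perm (inv_inj swap_idxK))) => [i|i j].
  by rewrite permE /= /D_gr /swap_idx gen_idxK; case: (gen_at i).
by rewrite !permE /= D_diff_swap.
Qed.

(** * Knot homology of D *)

Lemma mod_U_UV a b : mod_U (U ^+ a * V ^+ b) = 'X^b *+ (a == 0%N).
Proof.
rewrite /mod_U rmorphM !rmorphXn /= /horner_eval /U /V hornerX hornerC expr0n.
by rewrite mulr_natl.
Qed.

Lemma mod_V_swap p : mod_V p = mod_U (swapXY p).
Proof.
apply/polyP => i; rewrite /mod_U /mod_V coef_map /= /horner_eval.
by rewrite !horner_coef0 coef_swapXY.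
Qed.

(** Pairs the ends of the arrows surviving at U = 0, those with a pure power of V; every generator
    but [gy4] lies on exactly one. *)
Definition mate (s : gen) : gen :=
  match s with
  | gp1 => gx   | gx => gp1
  | gx3 => gx4  | gx4 => gx3
  | gp3 => gp2  | gp2 => gp3
  | gx2 => gx1  | gx1 => gx2
  | gh => gp4   | gp4 => gh
  | gx0 => gy1  | gy1 => gx0
  | gq2 => gq1  | gq1 => gq2
  | gy2 => gy3  | gy3 => gy2
  | gq4 => gx'  | gx' => gq4
  | gk => gq3   | gq3 => gk
  | gy4 => gy4
  end.

Definition source (s : gen) : bool :=
  match s with
  | gp1 | gx3 | gp3 | gx2 | gh | gx0 | gq2 | gy2 | gq4 | gk => true
  | _ => false
  end.

Definition vexp (s : gen) : nat :=
  match s with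
  | gx3 | gp3 | gx0 | gq2 | gy2 => 2
  | gx2 => 3
  | gp1 | gk => 4
  | gh | gq4 => 5
  | _ => 0
  end.

Lemma mod_U_D_diff i j : mod_U (D_diff i j) =
  if source (gen_at i) && (j == gen_idx (mate (gen_at i)))
  then 'X^(vexp (gen_at i)) else 0.
Proof.
rewrite -[i in LHS]gen_atK D_diffE /mod_U rmorph_sum /=.
under eq_bigr => m _ do rewrite rmorphMn /= -/(mod_U _) mod_U_UV.
by case: (gen_at i); rewrite /terms /= ?big_cons ?big_nil /= ?mulr0n ?mul0rn
  ?add0r ?addr0 //; case: eqP.
Qed.

Lemma D_knot_homology : knot_homology D.
Proof.
split.
(* The unmatched [gy4] has bidegree (0, 10), so gr_U = 0; the 5 below is the largest value of
   [vexp]. *)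
- exists (delta_mx 0 (gen_idx gy4)); split.
    exists 10 => j b; rewrite mxE eqxx /=.
    have [->|_] := eqVneq j; last by rewrite coef0.
    by rewrite coef1; case: b.
  apply: (@matching_free_generator 21 _ _ (fun i => gen_idx (mate (gen_at i)))
    (fun i => source (gen_at i)) (fun i => vexp (gen_at i)) 5) => //.
  + by move=> i; rewrite gen_idxK -[RHS]gen_atK; case: (gen_at i).
  + by move=> i; rewrite gen_idxK -{1}[i]gen_atK; case: (gen_at i).
  + by move=> i; case: (gen_at i).
  + by move=> i j; rewrite mxE mod_U_D_diff.
(* The case V = 0 is the case U = 0 conjugated by [swap], which sends [gy4] to [gx4]. *)
- exists (delta_mx 0 (gen_idx gx4)); split.
    exists 10 => j b; rewrite mxE eqxx /=.
    have [->|_] := eqVneq j; last by rewrite coef0.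
    by rewrite coef1; case: b.
  apply: (@matching_free_generator 21 _ _
    (fun i => gen_idx (swap (mate (swap (gen_at i)))))
    (fun i => source (swap (gen_at i))) (fun i => vexp (swap (gen_at i))) 5) => //.
  + by move=> i; rewrite gen_idxK -[RHS]gen_atK; case: (gen_at i).
  + by move=> i; rewrite gen_idxK -{1}[i]gen_atK; case: (gen_at i).
  + by move=> i; case: (gen_at i).
  + move=> i j; rewrite mxE mod_V_swap -D_diff_swap mod_U_D_diff.
    have -> : gen_at (swap_idx i) = swap (gen_at i) by rewrite gen_idxK.
    by rewrite (can2_eq swap_idxK swap_idxK) swap_idxE.
Qed.

Theorem theorem1p3 :
  knot_floer_like D /\
  (forall E : complex,
     knot_floer_like E -> tensor_form E -> ~ homotopy_equiv D E).
Proof.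
split; first by split; [exact: D_symmetric | exact: D_knot_homology].
by move=> E _; apply: D_not_tensor_form.
Qed.
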